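(* Let $n\ge 1$, $\alpha\in(\frac12,1)$, let $\mathbf v\in\mathbb R^n$ with $\mathbf v\ge 0$ and $\mathbf 1_n^\top \mathbf v=1$, and let $R\in\mathbb R^{n\times n^2}$ with $R\ge 0$ and $\mathbf 1_n^\top R=\mathbf 1_{n^2}^\top$. Let $\mathbf m$ be the minimal nonnegative solution of $\mathbf x=\alpha R(\mathbf x\otimes\mathbf x)+(1-\alpha)\mathbf v$, set $G'_{\mathbf m}=\alpha R(\mathbf m\otimes I_n)+\alpha R(I_n\otimes\mathbf m)$, and assume that $\mathbf m>0$ and that $G'_{\mathbf m}$ is irreducible. Let $\mathbf s$ be a stochastic solution of the same equation, and suppose that the matrix $H'_{\mathbf s-\mathbf m}$ (defined in the context) is nonsingular. Then the Perron–Newton method is locally convergent to $\mathbf s$: there is $\delta>0$ such that for every $\mathbf y_0\ge 0$ with $\mathbf 1_n^\top\mathbf y_0=\frac{2\alpha-1}{\alpha}$ and $\|\mathbf y_0-(\mathbf s-\mathbf m)\|<\delta$, the sequence $$\mathbf y_{k+1}=\mathbf y_k-(H'_{\mathbf y_k})^{-1}H(\mathbf y_k),\qquad k=0,1,\dots$$ is well defined (each $\mathbf y_k\ge 0$ and each $H'_{\mathbf y_k}$ is well defined and nonsingular) and $\mathbf m+\mathbf y_k\to\mathbf s$ as $k\to\infty$.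
   Context: $\mathbf 1_k$ denotes the column vector of all ones of length $k$; inequalities between vectors and matrices are componentwise; $\otimes$ is the Kronecker product. A vector $\mathbf s\in\mathbb R^n$ is stochastic if $\mathbf s\ge 0$ and $\mathbf 1_n^\top\mathbf s=1$. The minimal nonnegative solution is the (always existing, unique) solution $\mathbf m\ge 0$ such that $\mathbf m\le\mathbf x$ for every solution $\mathbf x\ge 0$; every stochastic solution $\mathbf s$ satisfies $\mathbf s\ge\mathbf m$, and $\mathbf 1_n^\top(\mathbf s-\mathbf m)=\frac{2\alpha-1}{\alpha}$. For an irreducible matrix $A\ge 0$, $\mathcal{PV}(A)$ denotes its Perron (right) eigenvector $\mathbf w$, normalized so that $\mathbf 1_n^\top\mathbf w=1$. For $\mathbf y\ge 0$ set $$P_{\mathbf y}=\alpha R(\mathbf y\otimes I_n)+G'_{\mathbf m},\quad \mathbf w(\mathbf y)=\mathcal{PV}(P_{\mathbf y}),\quad H(\mathbf y)=\mathbf y-\frac{2\alpha-1}{\alpha}\mathbf w(\mathbf y),$$ and, for $\mathbf y\ge 0$ with $\mathbf 1_n^\top \mathbf y=\frac{2\alpha-1}{\alpha}$, $$H'_{\mathbf y}=I_n+(2\alpha-1)\mathbf w(\mathbf y)\mathbf 1_n^\top-(2\alpha-1)\bigl(I_n-P_{\mathbf y}+\mathbf w(\mathbf y)\mathbf 1_n^\top\bigr)^{-1}R(I_n\otimes\mathbf w(\mathbf y)).$$ (This is the Jacobian of $H$ at such $\mathbf y$.) *)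

(* Defs.v *)
From HB Require Import structures.
From mathcomp Require Import all_boot all_order all_algebra all_fingroup.
From mathcomp Require Import mxtens complex.
From mathcomp Require Import all_classical all_reals all_analysis.

Set Implicit Arguments.
Unset Strict Implicit.
Unset Printing Implicit Defensive.

Import Order.TTheory GRing.Theory Num.Theory.
Import numFieldNormedType.Exports.

Local Open Scope classical_set_scope.
Local Open Scope ring_scope.

Section Matrices.
Context {K : realType}.

Definition mxle p q (A B : 'M[K]_(p, q)) : Prop := forall i j, A i j <= B i j.

Definition mxlt p q (A B : 'M[K]_(p, q)) : Prop := forall i j, A i j < B i j.

Definition ones k : 'cV[K]_k := const_mx 1.

Definition stochastic n (x : 'cV[K]_n) : Prop :=
  mxle 0 x /\ (ones n)^T *m x = 1%:M.

(* Up to a simultaneous permutation of rows and columns, a reducible matrix is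
   block upper triangular with nontrivial diagonal blocks of sizes [k] and
   [n - k]. *)
Definition reducible n (A : 'M[K]_n) : Prop :=
  exists (p : 'S_n) (k : nat), (0 < k < n)%N /\
    forall i j : 'I_n, (k <= i)%N -> (j < k)%N ->
      row_perm p (col_perm p A) i j = 0.

Definition irreducible n (A : 'M[K]_n) : Prop := ~ reducible A.

(* [eigenvalue] is stated with row vectors, but left and right eigenvalues of a
   square matrix coincide. For [0 < n] the set is finite and nonempty, so the
   supremum is a maximum. *)
Definition spectral_radius n (A : 'M[K]_n) : K :=
  sup [set r | exists2 z : K[i],
         eigenvalue (map_mx (real_complex K) A) z & r = Normc.normc z].

Definition is_perron_vector n (A : 'M[K]_n) (w : 'cV[K]_n) : Prop :=
  [/\ mxlt 0 w, A *m w = spectral_radius A *: w & (ones n)^T *m w = 1%:M].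

(* For irreducible [A >= 0] there is exactly one Perron vector, by the
   Perron-Frobenius theorem; the value is meaningful only in that case. *)
Definition PV n (A : 'M[K]_n) : 'cV[K]_n :=
  xget 0 [set w | is_perron_vector A w].

(* [x *t I_n] and [I_n *t x] have [1 * n] and [n * 1] columns, which are equal
   but not convertible to [n]. *)
Definition kron_cI n (x : 'cV[K]_n) : 'M[K]_(n * n, n) :=
  castmx (erefl, mul1n n) (x *t 1%:M).

Definition kron_Ic n (x : 'cV[K]_n) : 'M[K]_(n * n, n) :=
  castmx (erefl, muln1 n) ((1%:M : 'M[K]_n) *t x).

End Matrices.

Section PerronNewton.
Context {K : realType} {n : nat}.
Variables (alpha : K) (v : 'cV[K]_n) (R : 'M[K]_(n, n * n)).

Definition is_solution (x : 'cV[K]_n) : Prop :=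
  x = alpha *: (R *m (x *t x)) + (1 - alpha) *: v.

Definition is_minimal_solution (m : 'cV[K]_n) : Prop :=
  [/\ mxle 0 m, is_solution m
    & forall x, mxle 0 x -> is_solution x -> mxle m x].

Definition Gprime (x : 'cV[K]_n) : 'M[K]_n :=
  alpha *: (R *m kron_cI x) + alpha *: (R *m kron_Ic x).

Variable m : 'cV[K]_n.

Definition Pmat (y : 'cV[K]_n) : 'M[K]_n :=
  alpha *: (R *m kron_cI y) + Gprime m.

Definition wvec (y : 'cV[K]_n) : 'cV[K]_n := PV (Pmat y).

Definition Hfun (y : 'cV[K]_n) : 'cV[K]_n :=
  y - ((2 * alpha - 1) / alpha) *: wvec y.

Definition Hinner (y : 'cV[K]_n) : 'M[K]_n :=
  1%:M - Pmat y + wvec y *m (ones n)^T.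

(* The Jacobian of [Hfun] at [y] when [y >= 0] has entry sum
   [(2 alpha - 1) / alpha]; [invmx] is total, so the formula is meaningful only
   when [Hinner y] is invertible. *)
Definition Hprime (y : 'cV[K]_n) : 'M[K]_n :=
  1%:M + (2 * alpha - 1) *: (wvec y *m (ones n)^T)
  - (2 * alpha - 1) *: (invmx (Hinner y) *m (R *m kron_Ic (wvec y))).

Definition Hprime_defined (y : 'cV[K]_n) : Prop :=
  [/\ (ones n)^T *m y = ((2 * alpha - 1) / alpha)%:M,
      irreducible (Pmat y),
      is_perron_vector (Pmat y) (wvec y)
    & Hinner y \in unitmx].

Definition perron_newton (y0 : 'cV[K]_n) (k : nat) : 'cV[K]_n :=
  iter k (fun y => y - invmx (Hprime y) *m Hfun y) y0.

End PerronNewton.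

(* Main.v *)
Require Import Defs.
From mathcomp Require Import all_boot all_order all_algebra all_fingroup.
From mathcomp Require Import mxtens complex.
From mathcomp Require Import all_classical all_reals all_analysis.
From mathcomp Require Import ring lra.

(** Put [d = s - m], [c = (2 alpha - 1) / alpha] and [B x y = R (x ⊗ y)]. Once
    the entry sum of [m] is known to be [(1 - alpha) / alpha]
    ([minimal_solution_colsum]), the matrix [P_y] is column-stochastic for every
    [y >= 0] of entry sum [c], and it is irreducible because it dominates [G'_m].
    For such a matrix the spectral radius is 1, the positive fixed vector exists,
    and a fixed vector of entry sum zero vanishes ([irreducible_fixed_colsum0]);
    therefore [w(y)] is a Perron vector and
    [I - P_y + w(y) 1^T] is invertible. Subtracting the equations for [s] and [m]
    gives [P_d d = d], so [d = c w(d)]: thus [d] is a zero of [H], and [d > 0].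

    Convergence rests on two identities. Set [e = y - d]. As
    [P_y x - P_d x = alpha B e x] and [w(y) - w(d)] has entry sum zero,
      [(I - P_y + u 1^T) (w(y) - w(d)) = alpha B e w(d)] for every [u]
    ([w_difference]). Let [N y = (I - P_y + w(y) 1^T) H'_y], which is affine in
    [P_y] and [w(y)]. The Newton step [T y] then satisfies
      [N y (T y - d) = - (2 alpha - 1) B e (w(y) - w(d))]
    ([newton_error]). Taking [u = w(d)], the first identity shows that [w] is
    Lipschitz at [d] ([w_lipschitz]); hence [N y] stays invertible with bounded
    inverse near [d] ([cleared_near]), and the second identity gives
    [|T y - d| = O(|e|^2)]. In a small ball the error is at least halved
    ([newton_contraction]), and the iterates stay nonnegative because [d > 0].
    Their entry sum is preserved because the residual has entry sum zero
    ([colsum_newton]). *)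

Set Implicit Arguments.
Unset Strict Implicit.
Unset Printing Implicit Defensive.

Import Order.TTheory GRing.Theory Num.Theory.
Import numFieldNormedType.Exports.

Local Open Scope classical_set_scope.
Local Open Scope ring_scope.

(** * Entry sums *)

Section EntrySum.
Context {K : realType}.
Implicit Types n p : nat.

Definition colsum n (x : 'cV[K]_n) : K := \sum_i x i 0.

Lemma ones_mul n (x : 'cV[K]_n) : (ones n)^T *m x = (colsum x)%:M.
Proof.
apply/matrixP => i j; rewrite !ord1 !mxE eqxx mulr1n.
by apply: eq_bigr => k _; rewrite !mxE mul1r.
Qed.

Lemma ones_mulE n (x : 'cV[K]_n) c : (ones n)^T *m x = c%:M <-> colsum x = c.
Proof.
rewrite ones_mul; split=> [/matrixP/(_ 0 0)|-> //].
by rewrite !mxE !eqxx !mulr1n.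
Qed.

Lemma colsumD n (x y : 'cV[K]_n) : colsum (x + y) = colsum x + colsum y.
Proof. by rewrite -big_split; apply: eq_bigr => i _; rewrite mxE. Qed.

Lemma colsumZ n a (x : 'cV[K]_n) : colsum (a *: x) = a * colsum x.
Proof. by rewrite mulr_sumr; apply: eq_bigr => i _; rewrite mxE. Qed.

Lemma colsumN n (x : 'cV[K]_n) : colsum (- x) = - colsum x.
Proof. by rewrite -scaleN1r colsumZ mulN1r. Qed.

Lemma colsumB n (x y : 'cV[K]_n) : colsum (x - y) = colsum x - colsum y.
Proof. by rewrite colsumD colsumN. Qed.

Lemma colsum0 n : colsum (0 : 'cV[K]_n) = 0.
Proof. by rewrite /colsum big1 // => i _; rewrite mxE. Qed.

Lemma colsum_mul n p (A : 'M[K]_(n, p)) x :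
  (ones n)^T *m A = (ones p)^T -> colsum (A *m x) = colsum x.
Proof. by move=> A1; apply/ones_mulE; rewrite mulmxA A1 ones_mul. Qed.

Lemma stochastic_of_colsum n (A : 'M[K]_n) :
  (forall x, colsum (A *m x) = colsum x) -> (ones n)^T *m A = (ones n)^T.
Proof.
move=> A1; apply/matrixP => i j; rewrite ord1.
have := A1 (delta_mx j 0); rewrite -colE /colsum [in RHS](bigD1 j) //=.
rewrite [in RHS]big1 => [|k kj]; last by rewrite mxE (negbTE kj).
rewrite !mxE !eqxx addr0 /= => e; apply: etrans e; apply: eq_bigr => k _.
by rewrite !mxE mul1r.
Qed.

Lemma mul_col_ones n p (w : 'cV[K]_n) (x : 'cV[K]_p) :
  w *m (ones p)^T *m x = colsum x *: w.
Proof. by rewrite -mulmxA ones_mul mul_mx_scalar. Qed.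

Lemma nonneg_colsum0 n (x : 'cV[K]_n) : mxle 0 x -> colsum x = 0 -> x = 0.
Proof.
move=> x0 /eqP; rewrite psumr_eq0 => [/allP h|i _].
  by apply/matrixP => i j; rewrite ord1 mxE; apply/eqP/h/mem_index_enum.
by have := x0 i 0; rewrite mxE.
Qed.

Lemma le_colsum n (x : 'cV[K]_n) i : mxle 0 x -> x i 0 <= colsum x.
Proof.
move=> x0; rewrite /colsum (bigD1 i) //= lerDl sumr_ge0 // => j _.
by have := x0 j 0; rewrite mxE.
Qed.

End EntrySum.

(** * Kronecker products with the identity *)

Section Kronecker.
Context {K : realType} {n : nat}.
Implicit Types x y z : 'cV[K]_n.

Lemma tens_colE x y k j :
  (x *t y) k j = x (mxtens_unindex k).1 0 * y (mxtens_unindex k).2 0.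
Proof. by rewrite mxE; congr (x _ _ * y _ _); rewrite [LHS]ord1. Qed.

Lemma mul_kron_cI x y : kron_cI x *m y = x *t y.
Proof.
apply/matrixP => k j; rewrite tens_colE ord1 mxE.
rewrite (bigD1 (mxtens_unindex k).2) //= big1 => [|l lk];
  rewrite castmxE !mxE cast_ord_id.
  rewrite [(mxtens_unindex (cast_ord _ _)).1]ord1.
  rewrite (_ : (mxtens_unindex (cast_ord _ _)).2 = (mxtens_unindex k).2).
    by rewrite eqxx mulr1 addr0.
  by apply/val_inj; rewrite /= modn_mod.
rewrite (_ : (mxtens_unindex (cast_ord _ _)).2 = l).
  by rewrite eq_sym (negbTE lk) mulr0 mul0r.
by apply/val_inj; rewrite /= modn_small ?ltn_ord.
Qed.

Lemma mul_kron_Ic x y : kron_Ic y *m x = x *t y.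
Proof.
apply/matrixP => k j; rewrite tens_colE ord1 mxE.
rewrite (bigD1 (mxtens_unindex k).1) //= big1 => [|l lk];
  rewrite castmxE !mxE cast_ord_id.
  rewrite [(mxtens_unindex (cast_ord _ _)).2]ord1.
  rewrite (_ : (mxtens_unindex (cast_ord _ _)).1 = (mxtens_unindex k).1).
    by rewrite eqxx mul1r addr0 mulrC.
  by apply/val_inj; rewrite /= divn1.
rewrite (_ : (mxtens_unindex (cast_ord _ _)).1 = l).
  by rewrite eq_sym (negbTE lk) !mul0r.
by apply/val_inj; rewrite /= divn1.
Qed.

Lemma colsum_tens x y : colsum (x *t y : 'cV_(n * n)) = colsum x * colsum y.
Proof.
rewrite /colsum mulr_sum; apply: eq_bigr => k _; exact: tens_colE.
Qed.

End Kronecker.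

(** * Perron theory of irreducible column-stochastic matrices *)

Lemma unitmx_ker0 (F : fieldType) n (A : 'M[F]_n) :
  (forall x : 'cV[F]_n, A *m x = 0 -> x = 0) -> A \in unitmx.
Proof.
move=> A0; rewrite -unitmx_tr -row_free_unit -kermx_eq0.
apply/eqP/row_matrixP => i; rewrite row0; apply: trmx_inj; rewrite trmx0.
apply: A0; apply: trmx_inj; rewrite trmx_mul trmxK trmx0 -row_mul.
by rewrite mulmx_ker row0.
Qed.

Section Reducible.
Context {K : realType} {n : nat}.

(** The permutation required by [reducible] lists the complement of [Z] first,
    then [Z]. *)
Lemma reducible_by_set (A : 'M[K]_n) (Z : {set 'I_n}) i0 j0 :
  i0 \in Z -> j0 \notin Z ->
  (forall i j, i \in Z -> j \notin Z -> A i j = 0) -> reducible A.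
Proof.
move=> i0Z j0Z A0; pose l := enum (~: Z) ++ enum Z.
have size_l : size l = n by rewrite size_cat -!cardE addnC cardsC card_ord.
have uniq_l : uniq l.
  rewrite cat_uniq !enum_uniq /= andbT; apply/hasPn => i.
  by rewrite !mem_enum inE negbK.
have p_inj : injective (fun i : 'I_n => nth i l i).
  move=> i j; rewrite (set_nth_default i j) ?size_l // => /eqP.
  by rewrite nth_uniq ?size_l // => /eqP/val_inj.
exists (perm p_inj), #|~: Z|; split=> [|i j ki jk].
  apply/andP; split; first by apply/card_gt0P; exists j0; rewrite inE.
  rewrite -[X in (_ < X)%N]card_ord -(cardsC Z).
  rewrite -[X in (X < _)%N]add0n ltn_add2r.
  by apply/card_gt0P; exists i0.
rewrite !mxE !permE; apply: A0.
  rewrite nth_cat -cardE ltnNge ki /= -mem_enum mem_nth // -cardE.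
  rewrite -(ltn_add2r #|~: Z|) subnK // cardsC card_ord; exact: ltn_ord.
have : nth j (enum (~: Z)) j \in ~: Z by rewrite -mem_enum mem_nth // -cardE.
by rewrite nth_cat -cardE jk inE.
Qed.

Lemma irreducible_ge (A B : 'M[K]_n) :
  mxle 0 A -> mxle A B -> irreducible A -> irreducible B.
Proof.
move=> A0 AB irrA [p [k [kn Bpk]]]; apply: irrA.
exists p, k; split=> // i j ki jk.
have := Bpk i j ki jk; rewrite !mxE => B0.
apply/eqP; rewrite eq_le -{1}B0 AB.
by have := A0 (p i) (p j); rewrite mxE.
Qed.

End Reducible.

Section Perron.
Context {K : realType} {n : nat}.
Variable A : 'M[K]_n.
Hypotheses (A0 : mxle 0 A) (A1 : (ones n)^T *m A = (ones n)^T).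
Implicit Types x w : 'cV[K]_n.

Let A_ge0 i j : 0 <= A i j. Proof. by have := A0 i j; rewrite mxE. Qed.

(** Both sides have the same entry sum, so no entry can increase. *)
Lemma stochastic_subfixed x : mxle x (A *m x) -> A *m x = x.
Proof.
move=> xA; apply/eqP; rewrite -subr_eq0; apply/eqP/nonneg_colsum0.
  by move=> i j; have := xA i j; rewrite !mxE subr_ge0.
by rewrite colsumB colsum_mul // subrr.
Qed.

(** The triangle inequality makes the entrywise absolute value subfixed. *)
Lemma stochastic_fixed_norm x :
  A *m x = x -> A *m map_mx Num.norm x = map_mx Num.norm x.
Proof.
move=> Ax; apply: stochastic_subfixed => i j; rewrite mxE -{1}Ax !mxE.
apply: le_trans (ler_norm_sum _ _ _) _; apply: ler_sum => k _.
by rewrite !mxE normrM ger0_norm.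
Qed.

Hypothesis irrA : irreducible A.

(** Row [i] of [A x = x] with [x i = 0] forces [A i j = 0] wherever [x j > 0];
    hence the zero set of a nonzero [x] would reduce [A]. *)
Lemma irreducible_fixed_zero x i0 :
  mxle 0 x -> A *m x = x -> x i0 0 = 0 -> x = 0.
Proof.
move=> x0 Ax xi0; apply: contrapT => xN0; apply: irrA.
have [j0 xj0] : exists j0, x j0 0 != 0.
  apply: contrapT => h; apply: xN0; apply/matrixP => i j; rewrite ord1 mxE.
  by apply/eqP; apply: contrapT => /negP xi; apply: h; exists i.
apply: (@reducible_by_set _ _ A [set i | x i 0 == 0] i0 j0); rewrite ?inE //.
  by rewrite xi0.
move=> i j; rewrite !inE => /eqP xi xj.
have := xi; rewrite -{1}Ax mxE => /eqP; rewrite psumr_eq0 => [|k _]; last first.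
  by rewrite mulr_ge0 //; have := x0 k 0; rewrite mxE.
move=> /allP/(_ j (mem_index_enum j)); rewrite /= mulf_eq0 (negbTE xj) orbF.
by move/eqP.
Qed.

(** This is the simplicity of the eigenvalue 1. If [x i <= 0], then the
    nonnegative fixed vector [|x| + x] vanishes at [i], hence everywhere, so [x]
    has no positive entry and a zero entry sum. If there is no such [i], all the
    entries are positive with sum zero. *)
Lemma irreducible_fixed_colsum0 x : A *m x = x -> colsum x = 0 -> x = 0.
Proof.
move=> Ax x0; have Anx := stochastic_fixed_norm Ax.
case: (pselect (exists i, x i 0 <= 0)) => [[i xi]|h]; last first.
  apply: nonneg_colsum0 => // i j; rewrite ord1 mxE leNgt; apply/negP => xi.
  by apply: h; exists i; exact: ltW.
have xn0 : map_mx Num.norm x + x = 0.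
  apply: (@irreducible_fixed_zero _ i).
  - by move=> k l; rewrite !mxE -[x k l]opprK subr_ge0 opprK -normrN ler_norm.
  - by rewrite mulmxDr Anx Ax.
  - by rewrite !mxE ler0_norm // addNr.
apply: oppr_inj; rewrite oppr0; apply: nonneg_colsum0 => [|]; last first.
  by rewrite colsumN x0 oppr0.
move=> k l; have /matrixP/(_ k l) := xn0; rewrite !mxE => /eqP.
by rewrite addr_eq0 => /eqP <-.
Qed.

(** A kernel vector has entry sum zero, as [1^T (I - A) = 0] and [1^T u = 1];
    it is then a fixed vector of entry sum zero. *)
Lemma stochastic_deflation_unit u :
  colsum u = 1 -> 1%:M - A + u *m (ones n)^T \in unitmx.
Proof.
move=> u1; apply: unitmx_ker0 => x.
rewrite mulmxDl mul_col_ones mulmxBl mul1mx => e.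
have x0 : colsum x = 0.
  have := congr1 (@colsum K n) e.
  by rewrite colsumD colsumB colsum_mul // colsumZ u1 mulr1 subrr add0r colsum0.
apply: irreducible_fixed_colsum0 => //; apply/eqP; rewrite eq_sym -subr_eq0.
by move: e; rewrite x0 scale0r addr0 => ->.
Qed.

Hypothesis n_gt0 : (0 < n)%N.

(** Left eigenvectors suit column-stochastic matrices: at an entry [j] of maximal
    modulus, [z * v j] is a convex combination of the entries of [v]. *)
Lemma stochastic_eigenvalue_bound (z : K[i]) :
  eigenvalue (map_mx (real_complex K) A) z -> Normc.normc z <= 1.
Proof.
move=> /eigenvalueP[v vA /eqP v0].
have [i0 vi0] : exists i, v 0 i != 0.
  apply: contrapT => h; apply: v0; apply/matrixP => i j; rewrite ord1 mxE.
  by apply/eqP; apply: contrapT => /negP vj; apply: h; exists j.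
pose j := [arg max_(j > i0) Normc.normc (v 0 j)]%O.
have vj k : Normc.normc (v 0 k) <= Normc.normc (v 0 j).
  by rewrite /j; case: arg_maxP => // l _; apply.
have normc_sum (f : 'I_n -> K[i]) :
    Normc.normc (\sum_k f k) <= \sum_k Normc.normc (f k).
  elim/big_ind2: _ => [|x1 y1 x2 y2 h1 h2|//]; first by rewrite Normc.normc0.
  exact: le_trans (le_normcD _ _) (lerD h1 h2).
have normc_real (a : K) : 0 <= a -> Normc.normc a%:C%C = a.
  by move=> a0; rewrite /= expr0n addr0 sqrtr_sqr ger0_norm.
have vj_gt0 : 0 < Normc.normc (v 0 j).
  apply: lt_le_trans (vj i0); rewrite lt_def; apply/andP; split.
    by apply: contra vi0 => /eqP/Normc.eq0_normc ->.
  by case: (v 0 i0) => a b; exact: sqrtr_ge0.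
rewrite -(ler_pM2r vj_gt0) mul1r -Normc.normcM.
have -> : z * v 0 j = \sum_k v 0 k * (A k j)%:C%C.
  have /matrixP/(_ 0 j) := vA; rewrite !mxE => <-.
  by apply: eq_bigr => k _; rewrite mxE.
apply: le_trans (normc_sum _) _.
apply: (@le_trans _ _ (\sum_k Normc.normc (v 0 j) * A k j)).
  by apply: ler_sum => k _; rewrite Normc.normcM normc_real // ler_wpM2r.
have /matrixP/(_ 0 j) := A1; rewrite -mulr_sumr !mxE => A1j.
rewrite (_ : \sum_k A k j = 1) ?mulr1 //.
by rewrite -A1j; apply: eq_bigr => k _; rewrite !mxE mul1r.
Qed.

Lemma stochastic_spectral_radius : spectral_radius A = 1.
Proof.
pose E := [set r | exists2 z : K[i],
  eigenvalue (map_mx (real_complex K) A) z & r = Normc.normc z].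
have E1 : E 1.
  exists 1; last by rewrite Normc.normc1.
  apply/eigenvalueP; exists (map_mx (real_complex K) (ones n)^T).
    by rewrite -map_mxM A1 scale1r.
  apply/negP => /eqP/matrixP/(_ 0 (Ordinal n_gt0)); rewrite !mxE => /eqP.
  by rewrite rmorph1 oner_eq0.
have ubE : ubound E 1 by move=> _ [z zA ->]; exact: stochastic_eigenvalue_bound.
apply/eqP; rewrite eq_le; apply/andP; split.
  by apply: ge_sup; first by exists 1.
by apply: ub_le_sup => //; exists 1.
Qed.

(** [I - A] is singular because [1^T] annihilates it; the absolute value of a
    kernel vector is fixed, and positive by irreducibility. *)
Lemma stochastic_fixed_vector :
  exists w, [/\ mxlt 0 w, A *m w = w & colsum w = 1].
Proof.
have [w [w0 Aw]] : exists w, w != 0 /\ A *m w = w.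
  have [h|] := boolP (1%:M - A \in unitmx).
    have : (ones n)^T *m (1%:M - A) = 0 by rewrite mulmxBr mulmx1 A1 subrr.
    move=> /(congr1 (fun B => B *m invmx (1%:M - A))).
    rewrite mulmxK // mul0mx => /matrixP/(_ 0 (Ordinal n_gt0)).
    by rewrite !mxE => /eqP; rewrite oner_eq0.
  move=> /negP h; apply: contrapT => h'; apply: h; apply: unitmx_ker0 => x.
  rewrite mulmxBl mul1mx => /eqP; rewrite subr_eq0 => /eqP Ax.
  by apply/eqP; apply: contrapT => /negP x0; apply: h'; exists x.
have := stochastic_fixed_norm Aw; set z := map_mx _ _ => Az.
have z0 : mxle 0 z by move=> i j; rewrite !mxE.
have zpos i : 0 < z i 0.
  rewrite lt_def; apply/andP; split; last by have := z0 i 0; rewrite mxE.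
  apply: contra w0 => /eqP zi.
  have /matrixP z00 := irreducible_fixed_zero z0 Az zi.
  apply/eqP/matrixP => k l; have := z00 k l; rewrite !mxE => /eqP.
  by rewrite normr_eq0 => /eqP.
have tz : 0 < colsum z.
  by apply: lt_le_trans (zpos (Ordinal n_gt0)) _; exact: le_colsum.
exists ((colsum z)^-1 *: z); split.
- move=> i j; rewrite ord1 !mxE mulr_gt0 ?invr_gt0 //.
  by have := zpos i; rewrite mxE.
- by rewrite -scalemxAr Az.
- by rewrite colsumZ mulVf // gt_eqF.
Qed.

Lemma perron_vectorP w :
  is_perron_vector A w <-> [/\ mxlt 0 w, A *m w = w & colsum w = 1].
Proof.
rewrite /is_perron_vector stochastic_spectral_radius scale1r.
by split=> -[w0 Aw /ones_mulE w1].
Qed.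

Lemma PV_perron : is_perron_vector A (PV A).
Proof.
have [w /perron_vectorP wA] := stochastic_fixed_vector.
exact: (xgetPex 0 (ex_intro _ w wA)).
Qed.

Lemma perron_vector_unique w : A *m w = w -> colsum w = 1 -> PV A = w.
Proof.
move=> Aw w1; have /perron_vectorP[_ APV PV1] := PV_perron.
apply/eqP; rewrite -subr_eq0; apply/eqP/irreducible_fixed_colsum0.
  by rewrite mulmxBr Aw APV.
by rewrite colsumB w1 PV1 subrr.
Qed.

End Perron.

(** * Quantitative invertibility in the maximum norm *)

Section Bounds.
Context {K : realType}.

Lemma norm_entry_le p q (A : 'M[K]_(p, q)) i j : `|A i j| <= `|A|.
Proof.
rewrite [leRHS]/Num.Def.normr /= mx_normrE.
exact: (le_bigmax _ (fun ij : 'I_p * 'I_q => `|A ij.1 ij.2|) (i, j)).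
Qed.

Lemma norm_le_entries p q (A : 'M[K]_(p, q)) c :
  0 <= c -> (forall i j, `|A i j| <= c) -> `|A| <= c.
Proof.
move=> c0 Ac; rewrite [leLHS]/Num.Def.normr /= mx_normrE.
by apply: bigmax_le => // -[i j] _; exact: Ac.
Qed.

Lemma norm_sum_le p (f : 'I_p -> K) c :
  (forall i, `|f i| <= c) -> `|\sum_i f i| <= p%:R * c.
Proof.
move=> fc; apply: le_trans (ler_norm_sum _ _ _) _.
apply: le_trans (ler_sum _ (fun i _ => fc i)) _.
by rewrite sumr_const card_ord mulr_natl.
Qed.

Lemma norm_colsum_le p (x : 'cV[K]_p) : `|colsum x| <= p%:R * `|x|.
Proof. by apply: norm_sum_le => i; exact: norm_entry_le. Qed.

Lemma norm_mulmx_bound p q (A : 'M[K]_(p, q)) :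
  exists2 C, 0 < C & forall x : 'cV[K]_q, `|A *m x| <= C * `|x|.
Proof.
exists (q%:R * `|A| + 1) => [|x]; first by rewrite ltr_wpDl // mulr_ge0.
apply: (@le_trans _ _ (q%:R * `|A| * `|x|)); last by rewrite ler_wpM2r // lerDl.
apply: norm_le_entries => [|i j]; first by rewrite !mulr_ge0.
rewrite mxE -mulrA; apply: norm_sum_le => k; rewrite normrM.
by rewrite ler_pM // norm_entry_le.
Qed.

(** The maximum norm of the vector of reciprocals of [d] gives an explicit lower
    bound for its entries. *)
Lemma positive_near n (d : 'cV[K]_n) : mxlt 0 d ->
  exists2 eps, 0 < eps & forall x : 'cV[K]_n, `|x - d| < eps -> mxle 0 x.
Proof.
move=> d0; have d_gt0 i : 0 < d i 0 by have := d0 i 0; rewrite mxE.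
pose D : 'cV[K]_n := \col_i (d i 0)^-1.
have D1 : 0 < `|D| + 1 by rewrite ltr_wpDl.
exists (`|D| + 1)^-1 => [|x xd i j]; first by rewrite invr_gt0.
rewrite ord1 mxE; have := norm_entry_le (x - d) i 0; rewrite !mxE => xdi.
have di : (`|D| + 1)^-1 <= d i 0.
  rewrite -[leRHS]invrK lef_pV2 ?posrE ?invr_gt0 //.
  have := norm_entry_le D i 0; rewrite mxE gtr0_norm ?invr_gt0 // => Di.
  by apply: le_trans Di _; rewrite lerDl.
have : `|x i 0 - d i 0| <= d i 0.
  by apply: le_trans xdi _; apply: le_trans di; exact: ltW.
by rewrite ler_norml => /andP[h _]; move: h; rewrite lerBrDr addNr.
Qed.

(** For a square matrix this means invertibility with [|A^-1| <= C], without
    mentioning the inverse, which makes it stable under perturbation. *)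
Definition bounded_below n (C : K) (A : 'M[K]_n) :=
  forall x : 'cV[K]_n, `|x| <= C * `|A *m x|.

Lemma unitmx_bounded_below n (A : 'M[K]_n) :
  A \in unitmx -> exists2 C, 0 < C & bounded_below C A.
Proof.
move=> uA; have [C C0 CA] := norm_mulmx_bound (invmx A).
by exists C => // x; rewrite -{1}(mulKmx uA x); exact: CA.
Qed.

Lemma bounded_below_unitmx n C (A : 'M[K]_n) :
  bounded_below C A -> A \in unitmx.
Proof.
move=> CA; apply: unitmx_ker0 => x Ax; apply/eqP.
by rewrite -normr_le0 (le_trans (CA x)) // Ax normr0 mulr0.
Qed.

Lemma bounded_below_perturb n C q (A A' : 'M[K]_n) :
  0 < C -> bounded_below C A ->
  (forall x : 'cV[K]_n, `|A' *m x - A *m x| <= q * `|x|) ->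
  C * q <= 1 / 2 -> bounded_below (2 * C) A'.
Proof.
move=> C0 CA A'A Cq x.
have h1 : `|A *m x| <= `|A' *m x| + q * `|x|.
  rewrite -[A *m x](subKr (A' *m x)); apply: le_trans (ler_normB _ _) _.
  by rewrite lerD2l.
have h2 : `|x| <= C * `|A' *m x| + (C * q) * `|x|.
  by rewrite -mulrA -mulrDr; apply: le_trans (CA x) _; rewrite ler_pM2l.
have h3 : (C * q) * `|x| <= 1 / 2 * `|x| by rewrite ler_wpM2r.
move: h2 h3; rewrite -[2 * C * _]mulrA.
move: (C * `|_|) (C * q * `|x|) => Y Z; lra.
Qed.

End Bounds.

(** * The bilinear map R (x ⊗ y) *)

Section Bilinear.
Context {K : realType} {n : nat}.
Variable R : 'M[K]_(n, n * n).
Implicit Types x y z : 'cV[K]_n.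

Definition bil x y : 'cV[K]_n := R *m (x *t y).

Lemma bil_cI x y : R *m kron_cI x *m y = bil x y.
Proof. by rewrite -mulmxA mul_kron_cI. Qed.

Lemma bil_Ic x y : R *m kron_Ic y *m x = bil x y.
Proof. by rewrite -mulmxA mul_kron_Ic. Qed.

Lemma bilBr x y z : bil x (y - z) = bil x y - bil x z.
Proof. by rewrite -!bil_cI mulmxBr. Qed.

Lemma bilBl x y z : bil (x - y) z = bil x z - bil y z.
Proof. by rewrite -!bil_Ic mulmxBr. Qed.

Lemma norm_bil_bound :
  exists2 C, 0 < C & forall x y, `|bil x y| <= C * (`|x| * `|y|).
Proof.
have [C C0 CR] := norm_mulmx_bound R; exists C => // x y.
apply: le_trans (CR (x *t y)) _; rewrite ler_pM2l //.
apply: norm_le_entries => [|i j]; first by rewrite mulr_ge0.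
by rewrite tens_colE normrM ler_pM // norm_entry_le.
Qed.

Hypotheses (R0 : mxle 0 R) (R1 : (ones n)^T *m R = (ones (n * n))^T).

Lemma colsum_bil x y : colsum (bil x y) = colsum x * colsum y.
Proof. by rewrite colsum_mul // colsum_tens. Qed.

Lemma bil_mono x x' y y' : mxle 0 x -> mxle 0 y -> mxle x x' -> mxle y y' ->
  mxle (bil x y) (bil x' y').
Proof.
move=> x0 y0 xx' yy' i j; rewrite !mxE; apply: ler_sum => k _.
apply: ler_wpM2l; first by have := R0 i k; rewrite mxE.
have := x0 (mxtens_unindex k).1 0; have := y0 (mxtens_unindex k).2 0.
by rewrite !tens_colE !mxE => ? ?; apply: ler_pM.
Qed.

End Bilinear.

(** * Entry sum of the minimal solution *)

Section MinimalSolution.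
Context {K : realType} {n : nat}.
Variables (alpha : K) (v : 'cV[K]_n) (R : 'M[K]_(n, n * n)).
Hypotheses (alpha_gt : 1 / 2 < alpha) (alpha_lt : alpha < 1).
Hypotheses (v0 : mxle 0 v) (v1 : colsum v = 1).
Hypotheses (R0 : mxle 0 R) (R1 : (ones n)^T *m R = (ones (n * n))^T).

Let F x : 'cV[K]_n := alpha *: bil R x x + (1 - alpha) *: v.
Let X k := iter k F 0.
Let tau := (1 - alpha) / alpha.

Let alpha_gt0 : 0 < alpha. Proof. by move: alpha_gt; lra. Qed.

Let F_mono x y : mxle 0 x -> mxle x y -> mxle (F x) (F y).
Proof.
move=> x0 xy i j; have := bil_mono R0 x0 x0 xy xy i j.
by rewrite /F !mxE lerD2r ler_pM2l.
Qed.

(* Both facts carry over to the limit: the iterates increase, and their entry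
   sums stay below the smaller root [tau] of [t = alpha t ^ 2 + 1 - alpha]. *)
Let X_mono k : mxle 0 (X k) /\ mxle (X k) (X k.+1).
Proof.
have F0 : mxle 0 (F 0).
  move=> i j; have := bil_mono R0 (x := 0) (y := 0) (x' := 0) (y' := 0).
  move=> /(_ _ _ _ _ i j) b0; rewrite /F.
  have -> : bil R 0 0 = 0 by rewrite -bil_cI mulmx0.
  rewrite scaler0 add0r !mxE mulr_ge0 //; first by move: alpha_lt; lra.
  by have := v0 i j; rewrite mxE.
elim: k => [|k [IH1 IH2]]; first by split=> // i j; rewrite mxE.
by split; [move=> i j; exact: le_trans (IH1 i j) (IH2 i j) | exact: F_mono].
Qed.

Let X_colsum k : colsum (X k) <= tau.
Proof.
elim: k => [|k IH].
  by rewrite colsum0 divr_ge0 //; [move: alpha_lt; lra | exact: ltW].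
rewrite /= /F colsumD !colsumZ colsum_bil // v1 mulr1.
have -> : tau = alpha * (tau * tau) + (1 - alpha).
  by rewrite /tau; field; rewrite gt_eqF.
rewrite lerD2r ler_pM2l // ler_pM //.
all: by rewrite sumr_ge0 // => i _; have := (X_mono k).1 i 0; rewrite mxE.
Qed.

(** The limit of the fixed-point iteration started at zero. *)
Lemma small_solution_exists :
  exists x, [/\ mxle 0 x, is_solution alpha v R x & colsum x <= tau].
Proof.
have X_le k l i : (k <= l)%N -> X k i 0 <= X l i 0.
  move=> kl; rewrite -(subnK kl); elim: (l - k)%N => // d IH.
  exact: le_trans IH ((X_mono (d + k)).2 i 0).
have X_cvg i : cvgn (fun k => X k i 0).
  apply: nondecreasing_is_cvgn => [k l kl|]; first exact: X_le.
  exists tau => _ [k _ <-]; apply: le_trans (X_colsum k).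
  by apply: le_colsum; exact: (X_mono k).1.
pose L := \col_i limn (fun k => X k i 0).
have XL i j : (fun k => X k i j) @ \oo --> L i j.
  by rewrite ord1 mxE; exact: X_cvg.
have sum_cvg (p : nat) (f : 'I_p -> nat -> K) (l : 'I_p -> K) :
    (forall i, f i @ \oo --> l i) ->
    (fun k => \sum_i f i k) @ \oo --> \sum_i l i.
  by move=> fl; apply: cvg_big => [|i _]; [exact: add_continuous|exact: fl].
exists L; split.
- move=> i j; rewrite [_ i j]mxE; apply: cvgr_to_ge (XL i j) _.
  by apply: nearW => k; have := (X_mono k).1 i j; rewrite mxE.
- apply/matrixP => i j; rewrite ord1.
  have XSL : X k.+1 i 0 @[k --> \oo] --> L i 0.
    have := XL i 0; rewrite -(cvg_shiftS (fun k => X k i 0)); exact.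
  apply: (cvg_unique (@Rhausdorff K) XSL).
  rewrite /= /F /bil.
  have -> : (fun k => (alpha *: (R *m (X k *t X k)) + (1 - alpha) *: v) i 0) =
    (fun k => alpha * (\sum_l R i l * (X k (mxtens_unindex l).1 0 *
      X k (mxtens_unindex l).2 0)) + (1 - alpha) * v i 0).
    apply/funext => k; rewrite !mxE; congr (_ * _ + _).
    by apply: eq_bigr => l _; rewrite tens_colE.
  rewrite !mxE; apply: cvgD; last exact: cvg_cst.
  apply: cvgMl_tmp; apply: sum_cvg => l; apply: cvgMl_tmp; rewrite tens_colE.
  by apply: cvgM.
- have : (fun k => colsum (X k)) @ \oo --> colsum L.
    by apply: sum_cvg => i; exact: XL.
  by move=> /cvgr_to_le; apply; apply: nearW => k; exact: X_colsum.
Qed.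

(** Summing the entries of the equation leaves the roots [1] and [tau]; the
    solution of small entry sum, which bounds [m] from above, excludes [1]. *)
Lemma minimal_solution_colsum m :
  is_minimal_solution alpha v R m -> colsum m = tau.
Proof.
move=> [m0 mF mmin]; have [x [x0 xF xtau]] := small_solution_exists.
have mtau : colsum m <= tau.
  by apply: le_trans xtau; apply: ler_sum => i _; exact: mmin.
have /eqP : (colsum m - 1) * (alpha * colsum m - (1 - alpha)) = 0.
  have := congr1 (@colsum K n) mF.
  rewrite colsumD !colsumZ (colsum_bil R1 m m) v1 => e.
  move: e; move: (colsum m) => t e.
  have -> : (t - 1) * (alpha * t - (1 - alpha)) =
    alpha * (t * t) + (1 - alpha) * 1 - t by ring.
  by rewrite -e subrr.
rewrite mulf_eq0 !subr_eq0 => /orP[/eqP m1|/eqP am].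
  have : tau < 1 by rewrite /tau ltr_pdivrMr // mul1r; move: alpha_gt; lra.
  by rewrite -m1 ltNge mtau.
by rewrite /tau -am mulrC mulKf // gt_eqF.
Qed.

End MinimalSolution.

(** * The family of stochastic matrices P_y *)

Definition admissible (K : realType) n (alpha : K) (y : 'cV[K]_n) :=
  mxle 0 y /\ colsum y = (2 * alpha - 1) / alpha.

Section PerronFamily.
Context {K : realType} {n : nat}.
Variables (alpha : K) (R : 'M[K]_(n, n * n)) (m : 'cV[K]_n).
Hypothesis n_gt0 : (0 < n)%N.
Hypotheses (alpha_gt : 1 / 2 < alpha) (alpha_lt : alpha < 1).
Hypotheses (R0 : mxle 0 R) (R1 : (ones n)^T *m R = (ones (n * n))^T).
Hypotheses (m0 : mxle 0 m) (m1 : colsum m = (1 - alpha) / alpha).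
Hypothesis irrG : irreducible (Gprime alpha R m).
Implicit Types x y d : 'cV[K]_n.

Let c := (2 * alpha - 1) / alpha.
Notation bil := (bil R).
Notation admissible := (admissible alpha).
Notation P := (Pmat alpha R m).
Notation w := (wvec alpha R m).

Let alpha_gt0 : 0 < alpha. Proof. by move: alpha_gt; lra. Qed.

Let alphac : alpha * c = 2 * alpha - 1.
Proof. by rewrite /c mulrC divfK // gt_eqF. Qed.

Lemma Gprime_mul x y :
  Gprime alpha R x *m y = alpha *: bil x y + alpha *: bil y x.
Proof. by rewrite /Gprime mulmxDl -!scalemxAl bil_cI bil_Ic. Qed.

Lemma Pmat_mul y x : P y *m x = alpha *: bil y x + Gprime alpha R m *m x.
Proof. by rewrite /Pmat mulmxDl -!scalemxAl bil_cI. Qed.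

Lemma PmatB y d x : P y *m x - P d *m x = alpha *: bil (y - d) x.
Proof. by rewrite !Pmat_mul opprD addrACA subrr addr0 -scalerBr bilBl. Qed.

Let scaled_mul_ge0 (B : 'M[K]_(n * n, n)) :
  mxle 0 B -> mxle 0 (alpha *: (R *m B)).
Proof.
move=> B0 i j; rewrite !mxE; apply: mulr_ge0; first exact: ltW.
rewrite sumr_ge0 // => k _.
by rewrite mulr_ge0 //; [have := R0 i k | have := B0 k j]; rewrite mxE.
Qed.

Let kron_cI_ge0 y : mxle 0 y -> mxle 0 (kron_cI y).
Proof.
move=> y0 i j; rewrite castmxE !mxE cast_ord_id.
rewrite [(mxtens_unindex (cast_ord _ _)).1]ord1 mulr_ge0 ?ler0n //.
by have := y0 (mxtens_unindex i).1 0; rewrite mxE.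
Qed.

Let kron_Ic_ge0 y : mxle 0 y -> mxle 0 (kron_Ic y).
Proof.
move=> y0 i j; rewrite castmxE !mxE cast_ord_id.
rewrite [(mxtens_unindex (cast_ord _ _)).2]ord1 mulr_ge0 ?ler0n //.
by have := y0 (mxtens_unindex i).2 0; rewrite mxE.
Qed.

Lemma Gprime_ge0 : mxle 0 (Gprime alpha R m).
Proof.
move=> i j; have := scaled_mul_ge0 (kron_cI_ge0 m0) i j.
have := scaled_mul_ge0 (kron_Ic_ge0 m0) i j.
rewrite /Gprime; move: (alpha *: _) (alpha *: _) => A B.
by rewrite !mxE => ? ?; exact: addr_ge0.
Qed.

Lemma Pmat_ge_Gprime y : mxle 0 y -> mxle (Gprime alpha R m) (P y).
Proof.
move=> y0 i j; have := scaled_mul_ge0 (kron_cI_ge0 y0) i j.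
rewrite /Pmat; move: (alpha *: _) (Gprime _ _ _) => A B.
by rewrite !mxE lerDr.
Qed.

Section Admissible.
Variable y : 'cV[K]_n.
Hypothesis ya : admissible y.

Lemma Pmat_ge0 : mxle 0 (P y).
Proof.
by move=> i j; exact: le_trans (Gprime_ge0 i j) (Pmat_ge_Gprime ya.1 i j).
Qed.

Lemma Pmat_irreducible : irreducible (P y).
Proof. exact: irreducible_ge Gprime_ge0 (Pmat_ge_Gprime ya.1) irrG. Qed.

(** The column sums of [P y] are [alpha c + 2 (1 - alpha) = 1]. *)
Lemma Pmat_stochastic : (ones n)^T *m P y = (ones n)^T.
Proof.
apply: stochastic_of_colsum => x.
rewrite Pmat_mul Gprime_mul !colsumD !colsumZ !colsum_bil // ya.2 m1.
rewrite mulrA alphac.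
by field; rewrite gt_eqF.
Qed.

Lemma wvec_perron : is_perron_vector (P y) (w y).
Proof. exact: PV_perron Pmat_ge0 Pmat_stochastic Pmat_irreducible n_gt0. Qed.

Lemma wvec_fixed : P y *m w y = w y.
Proof.
by have /(perron_vectorP Pmat_ge0 Pmat_stochastic n_gt0)[] := wvec_perron.
Qed.

Lemma colsum_wvec : colsum (w y) = 1.
Proof.
by have /(perron_vectorP Pmat_ge0 Pmat_stochastic n_gt0)[] := wvec_perron.
Qed.

Lemma wvec_gt0 : mxlt 0 (w y).
Proof. by have [] := wvec_perron. Qed.

Lemma wvec_unique x : P y *m x = x -> colsum x = 1 -> w y = x.
Proof.
exact: perron_vector_unique Pmat_ge0 Pmat_stochastic Pmat_irreducible n_gt0 _.
Qed.

Lemma Hinner_unit : Hinner alpha R m y \in unitmx.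
Proof.
exact: stochastic_deflation_unit Pmat_ge0 Pmat_stochastic
  Pmat_irreducible _ colsum_wvec.
Qed.

Lemma Hprime_definedP : Hprime_defined alpha R m y.
Proof.
split; [by apply/ones_mulE; exact: ya.2 | exact: Pmat_irreducible
  | exact: wvec_perron | exact: Hinner_unit].
Qed.

End Admissible.

End PerronFamily.

(** * Newton's method for y = c w(y) *)

(** [P] is any affine family of column-stochastic matrices with linear part
    [alpha R (y ⊗ I)], and [w y] a normalized fixed vector of [P y]. All the
    estimates come from the linear system that it satisfies. *)
Section NewtonStep.
Context {K : realType} {n : nat}.
Variables (alpha : K) (R : 'M[K]_(n, n * n)).
Hypotheses (alpha_gt : 1 / 2 < alpha) (alpha_lt : alpha < 1).
Hypothesis R1 : (ones n)^T *m R = (ones (n * n))^T.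
Variables (P : 'cV[K]_n -> 'M[K]_n) (w : 'cV[K]_n -> 'cV[K]_n).
Implicit Types x y d : 'cV[K]_n.

Let c := (2 * alpha - 1) / alpha.
Notation bil := (bil R).
Notation admissible := (admissible alpha).

Definition inner y := 1%:M - P y + w y *m (ones n)^T.

Hypothesis PmatB : forall y d x, P y *m x - P d *m x = alpha *: bil (y - d) x.
Hypothesis Pstoch : forall y, admissible y -> (ones n)^T *m P y = (ones n)^T.
Hypothesis w_fixed : forall y, admissible y -> P y *m w y = w y.
Hypothesis w_colsum : forall y, admissible y -> colsum (w y) = 1.
Hypothesis inner_unit : forall y, admissible y -> inner y \in unitmx.

Definition residual y := y - c *: w y.

Definition jac y := 1%:M + (2 * alpha - 1) *: (w y *m (ones n)^T)
  - (2 * alpha - 1) *: (invmx (inner y) *m (R *m kron_Ic (w y))).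

Definition newton y := y - invmx (jac y) *m residual y.

(** The Jacobian with its inverse cleared: it is affine in [P y] and [w y], so
    that its variation with [y] needs no estimate of an inverse. *)
Definition cleared y := inner y *m jac y.

Let alpha_gt0 : 0 < alpha. Proof. by move: alpha_gt; lra. Qed.

Let alphac : alpha * c = 2 * alpha - 1.
Proof. by rewrite /c mulrC divfK // gt_eqF. Qed.

Section Admissible.
Variable y : 'cV[K]_n.
Hypothesis ya : admissible y.

Lemma inner_mul x : inner y *m x = x - P y *m x + colsum x *: w y.
Proof. by rewrite /inner mulmxDl mulmxBl mul1mx mul_col_ones. Qed.

Lemma jac_mul x : jac y *m x =
  x + ((2 * alpha - 1) * colsum x) *: w y
  - (2 * alpha - 1) *: (invmx (inner y) *m bil x (w y)).
Proof.
rewrite /jac; move: (inner _) => I.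
rewrite mulmxBl mulmxDl mul1mx -!scalemxAl mul_col_ones scalerA.
by rewrite -[invmx _ *m _ *m _]mulmxA bil_Ic.
Qed.

Lemma cleared_mul x :
  cleared y *m x = x - P y *m x + (2 * alpha * colsum x) *: w y
                  - (2 * alpha - 1) *: bil x (w y).
Proof.
rewrite -mulmxA jac_mul mulmxBr mulmxDr -!scalemxAr.
rewrite (mulKVmx (inner_unit ya)) inner_mul (inner_mul (w y)).
rewrite (w_fixed ya) (w_colsum ya).
rewrite subrr add0r scale1r.
move: (P y *m x) (bil x _) (colsum x) => p b t.
by apply/matrixP => i j; rewrite !mxE; ring.
Qed.

Lemma cleared_unit : (cleared y \in unitmx) = (jac y \in unitmx).
Proof. by rewrite unitmx_mul (inner_unit ya). Qed.

Lemma colsum_inner x : colsum (inner y *m x) = colsum x.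
Proof.
rewrite inner_mul colsumD colsumB (colsum_mul _ (Pstoch ya)) subrr add0r.
by rewrite colsumZ (w_colsum ya) mulr1.
Qed.

Lemma colsum_cleared x : colsum (cleared y *m x) = colsum x.
Proof.
rewrite cleared_mul colsumB colsumD colsumB (colsum_mul _ (Pstoch ya)).
rewrite subrr add0r.
rewrite !colsumZ colsum_bil // (w_colsum ya); ring.
Qed.

End Admissible.

(** Both factors of [cleared y] preserve entry sums, and the residual has entry
    sum zero. *)
Lemma colsum_newton y : admissible y -> jac y \in unitmx ->
  colsum (newton y) = c.
Proof.
move=> ya uH; rewrite /newton colsumB ya.2 -(colsum_cleared ya) /cleared.
rewrite -mulmxA mulKVmx // (colsum_inner ya) /residual colsumB colsumZ.
by rewrite (w_colsum ya) ya.2 mulr1 subrr subr0.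
Qed.

Variable d : 'cV[K]_n.
Hypotheses (da : admissible d) (w_d : d = c *: w d).

(** [u] is arbitrary because [w y - w d] has entry sum zero. With [u := w y] the
    matrix is [inner y]; with [u := w d] it depends on [y] through [P y] only,
    which gives the Lipschitz estimate of [w]. *)
Lemma w_difference y u : admissible y ->
  (1%:M - P y + u *m (ones n)^T) *m (w y - w d) = alpha *: bil (y - d) (w d).
Proof.
move=> ya; have := PmatB y d (w d); rewrite (w_fixed da) => <-.
have cs : colsum (w y - w d) = 0.
  by rewrite colsumB (w_colsum ya) (w_colsum da) subrr.
have := w_fixed ya; move: cs; move: (w y) (w d) (P y) => a b Py cs ab.
rewrite mulmxDl mul_col_ones cs scale0r addr0 mulmxBl mul1mx mulmxBr ab.
by rewrite opprB addrC addrA subrK.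
Qed.

(** The error of a step is an exact bilinear expression in [y - d] and
    [w y - w d], and the latter is [O(|y - d|)]; hence quadratic convergence. *)
Lemma newton_error y : admissible y -> jac y \in unitmx ->
  cleared y *m (newton y - d) = - (2 * alpha - 1) *: bil (y - d) (w y - w d).
Proof.
move=> ya uH; rewrite /newton addrAC mulmxBr.
rewrite {2}/cleared -[_ *m _ *m (invmx _ *m _)]mulmxA (mulKVmx uH).
have -> : residual y = (y - d) - c *: (w y - w d).
  by rewrite /residual {1}w_d scalerBr opprB addrA subrK.
have He : inner y *m (w y - w d) = alpha *: bil (y - d) (w d).
  exact: w_difference.
have cs : colsum (y - d) = 0 by rewrite colsumB ya.2 da.2 subrr.
rewrite [inner _ *m _]mulmxBr -scalemxAr He cleared_mul // inner_mul cs.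
rewrite scalerA [c * _]mulrC alphac bilBr.
move: (P y *m _) (bil _ (w y)) (bil _ (w d)) => p b b'.
by apply/matrixP => i j; rewrite !mxE; ring.
Qed.

Lemma cleared_difference y x : admissible y ->
  cleared y *m x - cleared d *m x =
  - (alpha *: bil (y - d) x) + (2 * alpha * colsum x) *: (w y - w d)
  - (2 * alpha - 1) *: bil x (w y - w d).
Proof.
move=> ya; rewrite !cleared_mul // -PmatB bilBr.
move: (P y *m x) (P d *m x) (bil x _) (bil x _) (colsum x) => p p' b b' t.
by apply/matrixP => i j; rewrite !mxE; ring.
Qed.

(** For [y] close to [d], [I - P y + w(d) 1^T] is a small perturbation of the
    invertible matrix [inner d]. *)
Lemma w_lipschitz : exists eps L, [/\ 0 < eps, 0 < L &
  forall y, admissible y -> `|y - d| <= eps -> `|w y - w d| <= L * `|y - d|].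
Proof.
have [B B0 bB] := norm_bil_bound R.
have [C C0 HC] := unitmx_bounded_below (inner_unit da).
exists (2 * C * B)^-1, (2 * C * B * (`|w d| + 1)); split.
- by rewrite invr_gt0 !mulr_gt0.
- by rewrite !mulr_gt0 // ltr_wpDl.
move=> y ya ye; set e := y - d in ye *.
have HCy : bounded_below (2 * C) (1%:M - P y + w d *m (ones n)^T).
  apply: (bounded_below_perturb (q := B * `|e|) C0 HC) => [x|]; last first.
    rewrite mulrA -ler_pdivlMl ?mulr_gt0 //; apply: le_trans ye _.
    rewrite -mulrA invfM mulrC; lra.
  rewrite inner_mul // mulmxDl mul_col_ones mulmxBl mul1mx.
  have -> : x - P y *m x + colsum x *: w d - (x - P d *m x + colsum x *: w d) =
      - (alpha *: bil e x).
    rewrite -PmatB; move: (P y *m x) (P d *m x) => p p'.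
    by apply/matrixP => i j; rewrite !mxE; ring.
  rewrite normrN normrZ gtr0_norm //; apply: (@le_trans _ _ (1 * `|bil e x|)).
    by rewrite ler_wpM2r // ltW.
  by rewrite mul1r -mulrA; exact: bB.
apply: le_trans (HCy _) _; rewrite w_difference //.
rewrite -!mulrA ler_pM2l // ler_pM2l //.
rewrite normrZ gtr0_norm //.
apply: (@le_trans _ _ (1 * `|bil e (w d)|)); first by rewrite ler_wpM2r // ltW.
rewrite mul1r; apply: le_trans (bB _ _) _; rewrite ler_pM2l // mulrC.
by rewrite ler_wpM2r // lerDl.
Qed.

(** By [w_lipschitz], [cleared y] differs from the invertible matrix [cleared d]
    by [O(|y - d|)]. *)
Lemma cleared_near : jac d \in unitmx ->
  exists eps C, [/\ 0 < eps, 0 < C &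
    forall y, admissible y -> `|y - d| <= eps -> bounded_below C (cleared y)].
Proof.
move=> uH; have [B B0 bB] := norm_bil_bound R.
have [eps [L [eps0 L0 wL]]] := w_lipschitz.
have uHd : cleared d \in unitmx by rewrite cleared_unit.
have [C C0 HC] := unitmx_bounded_below uHd.
pose Q := B + 2 * n%:R * L + B * L.
have Q0 : 0 < Q.
  by rewrite ltr_wpDr ?ltr_wpDr // ?mulr_ge0 // ltW.
exists (Num.min eps (2 * C * Q)^-1), (2 * C); split.
- by rewrite lt_min eps0 invr_gt0 !mulr_gt0.
- by rewrite mulr_gt0.
move=> y ya; rewrite le_min => /andP[ye yQ].
have wyd := wL _ ya ye; set e := y - d in ye yQ wyd *.
apply: (bounded_below_perturb (q := Q * `|e|) C0 HC) => [x|]; last first.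
  rewrite mulrA -ler_pdivlMl ?mulr_gt0 //; apply: le_trans yQ _.
  rewrite -mulrA invfM mulrC; lra.
rewrite cleared_difference // -/e.
have a1 : `|alpha| <= 1 by rewrite gtr0_norm // ltW.
have a2 : `|2 * alpha| <= 2.
  by rewrite gtr0_norm ?mulr_gt0 //; move: alpha_lt; lra.
have a3 : `|2 * alpha - 1| <= 1.
  by rewrite gtr0_norm; move: alpha_gt alpha_lt; lra.
have n1 : `|- (alpha *: bil e x)| <= B * `|e| * `|x|.
  rewrite normrN normrZ -mulrA -[leRHS]mul1r; apply: ler_pM => //; exact: bB.
have n2 : `|(2 * alpha * colsum x) *: (w y - w d)| <=
    2 * n%:R * L * `|e| * `|x|.
  rewrite normrZ normrM.
  have -> : 2 * n%:R * L * `|e| * `|x| = 2 * (n%:R * `|x|) * (L * `|e|) by ring.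
  by apply: ler_pM => //; apply: ler_pM => //; exact: norm_colsum_le.
have n3 : `|(2 * alpha - 1) *: bil x (w y - w d)| <= B * L * `|e| * `|x|.
  rewrite normrZ.
  have -> : B * L * `|e| * `|x| = 1 * (B * (`|x| * (L * `|e|))) by ring.
  apply: ler_pM => //; apply: le_trans (bB _ _) _.
  by rewrite ler_pM2l // ler_wpM2l.
have -> : Q * `|e| * `|x| = B * `|e| * `|x| + 2 * n%:R * L * `|e| * `|x| +
  B * L * `|e| * `|x| by rewrite /Q; ring.
apply: le_trans (ler_normB _ _) _; apply: lerD => //.
by apply: le_trans (ler_normD _ _) _; apply: lerD.
Qed.

(** In [newton_error] the factor [C B L |y - d|] drops below [1 / 2]; the radius
    of [positive_near] then keeps the next iterate nonnegative as well. *)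
Lemma newton_contraction : mxlt 0 d -> jac d \in unitmx ->
  exists2 delta, 0 < delta & forall y, admissible y -> `|y - d| < delta ->
    [/\ jac y \in unitmx, admissible (newton y)
      & `|newton y - d| <= 1 / 2 * `|y - d|].
Proof.
move=> d0 uH; have [B B0 bB] := norm_bil_bound R.
have [eps1 eps10 dpos] := positive_near d0.
have [eps2 [L [eps20 L0 wL]]] := w_lipschitz.
have [eps3 [C [eps30 C0 HC]]] := cleared_near uH.
exists (Num.min (Num.min eps1 eps2) (Num.min eps3 (2 * (C * B * L))^-1)).
  by rewrite !lt_min eps10 eps20 eps30 invr_gt0 !mulr_gt0.
move=> y ya; rewrite !lt_min => /andP[/andP[y1 y2] /andP[y3 y4]].
have wyd := wL _ ya (ltW y2); have HCy := HC _ ya (ltW y3).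
have uHy : jac y \in unitmx.
  by rewrite -cleared_unit //; exact: bounded_below_unitmx HCy.
have half : `|newton y - d| <= 1 / 2 * `|y - d|.
  apply: le_trans (HCy _) _; rewrite newton_error // normrZ normrN.
  have a3 : `|2 * alpha - 1| <= 1.
    by rewrite gtr0_norm; move: alpha_gt alpha_lt; lra.
  set e := y - d in y4 wyd *.
  apply: (@le_trans _ _ (C * (1 * (B * (`|e| * (L * `|e|)))))).
    rewrite ler_pM2l //; apply: ler_pM => //; apply: le_trans (bB _ _) _.
    by rewrite ler_pM2l // ler_wpM2l.
  have -> : C * (1 * (B * (`|e| * (L * `|e|)))) = (C * B * L * `|e|) * `|e|.
    by ring.
  rewrite ler_wpM2r // -ler_pdivlMl ?mulr_gt0 //; apply: le_trans (ltW y4) _.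
  by rewrite invfM mulrC; lra.
split=> //; split; last exact: colsum_newton.
apply: dpos; apply: le_lt_trans half _; apply: le_lt_trans y1.
by have := normr_ge0 (y - d); lra.
Qed.

End NewtonStep.

(** * Local convergence *)

Theorem theorem8 (K : realType) (n : nat) (alpha : K) (v : 'cV[K]_n)
    (R : 'M[K]_(n, n * n)) (m s : 'cV[K]_n) :
  (1 <= n)%N ->
  1 / 2 < alpha < 1 ->
  mxle 0 v -> (ones n)^T *m v = 1%:M ->
  mxle 0 R -> (ones n)^T *m R = (ones (n * n))^T ->
  is_minimal_solution alpha v R m ->
  mxlt 0 m ->
  irreducible (Gprime alpha R m) ->
  stochastic s -> is_solution alpha v R s ->
  Hprime alpha R m (s - m) \in unitmx ->
  exists delta : K, 0 < delta /\
    forall y0 : 'cV[K]_n,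
      mxle 0 y0 ->
      (ones n)^T *m y0 = ((2 * alpha - 1) / alpha)%:M ->
      `|y0 - (s - m)| < delta ->
      let y := perron_newton alpha R m y0 in
      (forall k : nat,
         [/\ mxle 0 (y k),
             Hprime_defined alpha R m (y k)
           & Hprime alpha R m (y k) \in unitmx]) /\
      (fun k : nat => m + y k) @ \oo --> s.
Proof.
move=> n_gt0 /andP[alpha_gt alpha_lt] v0 /ones_mulE v1 R0 R1 mmin m_gt0 irrG.
move=> [s0 /ones_mulE s1] s_sol uH.
have alpha_gt0 : 0 < alpha by lra.
have [m0 m_sol m_le] := mmin.
have m1 := minimal_solution_colsum alpha_gt alpha_lt v0 v1 R0 R1 mmin.
set c := (2 * alpha - 1) / alpha.
have c_gt0 : 0 < c by rewrite divr_gt0 //; lra.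
have cN0 : c != 0 by rewrite gt_eqF.
pose d := s - m; rewrite -/d in uH *.
have da : admissible alpha d.
  split=> [i j|]; first by rewrite !mxE subr_ge0; exact: m_le.
  by rewrite colsumB s1 m1; field; rewrite gt_eqF.
(* Subtract the two quadratic equations: P_d d is their difference. *)
have d_fixed : Pmat alpha R m d *m d = d.
  rewrite Pmat_mul Gprime_mul -!scalerDr /d [in RHS]s_sol [in RHS]m_sol.
  rewrite opprD addrACA subrr addr0 -scalerBr; congr (_ *: _).
  rewrite -/(bil R s s) -/(bil R m m) !(bilBl, bilBr).
  move: (bil R s s) (bil R s m) (bil R m s) (bil R m m) => ss sm ms mm.
  by apply/matrixP => i j; rewrite !mxE; ring.
have wd : wvec alpha R m d = c^-1 *: d.
  apply: wvec_unique => //; first by rewrite -scalemxAr d_fixed.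
  by rewrite colsumZ da.2 mulVf.
have d_eq : d = c *: wvec alpha R m d by rewrite wd scalerA divff // scale1r.
have d_gt0 : mxlt 0 d.
  move=> i j; rewrite d_eq !mxE mulr_gt0 //.
  have wa : mxlt 0 (wvec alpha R m d) by exact: wvec_gt0.
  by have := wa i j; rewrite mxE.
have [delta delta_gt0 newtonP] :
  exists2 delta, 0 < delta & forall y, admissible alpha y -> `|y - d| < delta ->
    [/\ Hprime alpha R m y \in unitmx,
        admissible alpha (newton alpha R (Pmat alpha R m) (wvec alpha R m) y)
      & `|newton alpha R (Pmat alpha R m) (wvec alpha R m) y - d| <=
        1 / 2 * `|y - d|].
  (* [Hprime] and the Perron-Newton step are instances of [jac] and [newton]. *)
  apply: newton_contraction => //.
  - by move=> y d' x; exact: PmatB.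
  - by move=> y ya; exact: Pmat_stochastic.
  - by move=> y ya; exact: wvec_fixed.
  - by move=> y ya; exact: colsum_wvec.
  - by move=> y ya; exact: Hinner_unit.
exists delta; split; first exact: delta_gt0.
move=> y0 y0_ge0 /ones_mulE y0c y0d y.
have yP k : admissible alpha (y k) /\ `|y k - d| <= (1 / 2) ^+ k * `|y0 - d|.
  elim: k => [|k [ya yd]]; first by rewrite expr0 mul1r.
  have ydelta : `|y k - d| < delta.
    apply: le_lt_trans yd _; apply: le_lt_trans y0d.
    rewrite ler_piMl // exprn_ile1 //; lra.
  have [_ ya' yd'] := newtonP _ ya ydelta; split=> //.
  by apply: le_trans yd' _; rewrite exprS -[leRHS]mulrA ler_pM2l //; lra.
have ydelta k : `|y k - d| < delta.
  apply: le_lt_trans (yP k).2 _; apply: le_lt_trans y0d.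
  rewrite ler_piMl // exprn_ile1 //; lra.
split=> [k|].
  have [ya _] := yP k; have [uHy _ _] := newtonP _ ya (ydelta k).
  split; [exact: ya.1 | | exact: uHy].
  exact: (Hprime_definedP n_gt0 alpha_gt R0 R1 m0 m1 irrG ya).
have geo : (fun k => (1 / 2) ^+ k * `|y0 - d|) @ \oo --> (0 : K).
  rewrite -[X in _ --> X](mul0r `|y0 - d|); apply: cvgMr_tmp; apply: cvg_expr.
  by rewrite ger0_norm; lra.
apply/cvgrPdist_le => eps eps_gt0.
have /cvgr0Pnorm_le/(_ _ eps_gt0) := geo.
apply: filterS => k; rewrite ger0_norm => [hk|]; last first.
  by rewrite mulr_ge0 // exprn_ge0 //; lra.
have -> : s - (m + y k) = - (y k - d) by rewrite /d !opprB opprD addrA.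
by rewrite normrN; apply: le_trans (yP k).2 _.
Qed.
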